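(* Let $G$ be a chordal graph with family of overspan graphs $\mathcal A=\mathcal A(G)$ (defined in the context). For every $\mathcal B\subseteq\mathcal A$, $\nu(G_{\mathcal B})=\tau(G_{\mathcal B})$.
   Context: A tree representation of a graph $G$ is a tree $T_0$ with a family $\mathcal F=\{F_v: v\in V(G)\}$ of subtrees of $T_0$ such that for distinct $u,v$, $uv\in E(G)$ iff $F_u$ and $F_v$ share a vertex. Fix one with $|V(T_0)|$ minimum. Choose an independent set $I$ of $G$ maximal with the property that for each $v\in I$, $F_v$ is a path all of whose vertices have degree at most $2$ in $T_0$; moreover $I$ is chosen so that for every $v\in I$, $F_v$ contains no member of $\mathcal F$ as a proper subgraph. For $v\in I$, $F_v$ is an $I$-path (trivial if it is a single vertex, which is then its endvertex). Colour each edge of $T_0$ red if it lies in some $I$-path and black otherwise. The base tree $T$ is obtained from $T_0$ by suppressing, one by one, every degree-$2$ vertex that is not an endvertex of any $I$-path; edges of $T$ inherit the colours. For an edge $e=rs$ of $T$, the overspan graph $A_e$ has vertex set $V(G)\setminus I$; it has a loop at $v$ if $F_v$ contains both $r$ and $s$, and an edge between distinct $u,v$ if $uv\in E(G)$ and ($r\in V(F_u)$, $s\in V(F_v)$ or vice versa). The family $\mathcal A(G)$ contains one graph $A_e$ for each red edge $e$ of $T$ and two copies of $A_e$ for each black edge $e$ of $T$. For $\mathcal B\subseteq\mathcal A$, $G_{\mathcal B}$ is the graph on $V(G)\setminus I$ whose edge set (including loops) is the union of the edge sets of members of $\mathcal B$. $\nu(H)$ is the maximum size of a matching of $H$, where a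 matching may contain loops provided all its edges are pairwise vertex-disjoint; $\tau(H)$ is the minimum size of a vertex set meeting every edge of $H$ (so every vertex carrying a loop must be in it). *)

(* Defs.v *)
From mathcomp Require Import all_boot.
Set Implicit Arguments.
Unset Strict Implicit.
Unset Printing Implicit Defensive.

Section SimpleGraphs.

Variables (V : finType) (G : rel V).

Definition simple_graph : Prop := symmetric G /\ irreflexive G.

Definition chordal : Prop :=
  forall c : seq V, ucycle G c -> 3 < size c ->
    exists x y, [/\ x \in c, y \in c, G x y, y != next c x & y != prev c x].

Definition degree (x : V) : nat := #|[set y | G x y]|.

Definition independent (J : {set V}) : Prop := {in J &, forall u v, ~~ G u v}.

(* The subgraph of G induced by A is connected, resp. acyclic.  A ucycle of
   size 2 is a single edge traversed back and forth, hence the bound. *)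
Definition connected_on (A : {set V}) : Prop :=
  {in A &, forall x y, connect [rel a b | [&& a \in A, b \in A & G a b]] x y}.

Definition acyclic_on (A : {set V}) : Prop :=
  forall c : seq V, {subset c <= A} -> ucycle G c -> size c <= 2.

Definition tree_on (A : {set V}) : Prop :=
  [/\ A != set0, connected_on A & acyclic_on A].

(* When G is a tree, so that A induces exactly the edges between consecutive
   vertices of the sequence: A is a path having x as an endvertex.  The only
   vertex of a trivial path is its endvertex. *)
Definition endvertex (A : {set V}) (x : V) : Prop :=
  exists p, [/\ path G x p, uniq (x :: p) & A = [set y in x :: p]].

Definition is_path (A : {set V}) : Prop := exists x, endvertex A x.

End SimpleGraphs.

(* A subtree of a tree is an induced subgraph, so it is given by its vertex
   set. *)
Definition tree_representation (V : finType) (G : rel V) (T0 : finType)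
    (t0 : rel T0) (F : V -> {set T0}) : Prop :=
  [/\ simple_graph t0, tree_on t0 [set: T0], forall v, tree_on t0 (F v)
    & forall u v, u != v -> G u v = (F u :&: F v != set0)].

Definition min_tree_representation (V : finType) (G : rel V) (T0 : finType)
    (t0 : rel T0) (F : V -> {set T0}) : Prop :=
  tree_representation G t0 F /\
  forall (T1 : finType) (t1 : rel T1) (F1 : V -> {set T1}),
    tree_representation G t1 F1 -> #|T0| <= #|T1|.

(* Undirected graphs with loops allowed: symmetric relations H, with a loop at
   x when H x x; the corresponding edge is then [set x; x] = [set x]. *)
Section LoopGraphs.

Variables (W : finType) (H : rel W).

Definition edges : {set {set W}} :=
  [set e : {set W} | [exists x, exists y, H x y && (e == [set x; y])]].

Definition matching (M : {set {set W}}) : bool :=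
  (M \subset edges) && trivIset M.

Definition vertex_cover (C : {set W}) : bool :=
  [forall e in edges, e :&: C != set0].

Definition nu : nat := \max_(M : {set {set W}} | matching M) #|M|.

Definition tau : nat := #|[arg min_(C < [set: W] | vertex_cover C) #|C|]|.

End LoopGraphs.

(* cred is the relation of the red edges; the other edges are black. *)
Record cgraph (T : finType) := CGraph {
  cverts : {set T};
  cadj : rel T;
  cred : rel T
}.

(* Suppression of a vertex w of degree 2: w is deleted and its two neighbours
   are joined.  The new edge is red when the two edges it replaces are red; for
   the vertices suppressed below these two edges have the same colour, as an
   I-path through one of them has w as an inner vertex. *)
Definition suppress (T : finType) (K : cgraph T) (w : T) : cgraph T :=
  CGraph
    (cverts K :\ w)
    [rel x y | [&& x != w, y != w, x != y
                 & cadj K x y || (cadj K x w && cadj K w y)]]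
    [rel x y | [&& x != w, y != w, x != y
                 & cred K x y || (cred K x w && cred K w y)]].

Section Overspan.

Variables (V : finType) (G : rel V).
Variables (T0 : finType) (t0 : rel T0) (F : V -> {set T0}).

Definition path_independent (J : {set V}) : Prop :=
  independent G J /\
  {in J, forall v, is_path t0 (F v) /\ {in F v, forall x, degree t0 x <= 2}}.

Definition valid_I (I : {set V}) : Prop :=
  [/\ path_independent I,
      forall J : {set V}, path_independent J -> I \subset J -> J = I
    & {in I, forall v u, ~~ (F u \proper F v)}].

Variable I : {set V}.

Definition red_edge : rel T0 :=
  [rel x y | t0 x y && [exists v in I, (x \in F v) && (y \in F v)]].

Definition suppressible (w : T0) : Prop :=
  degree t0 w = 2 /\ ~ (exists2 v, v \in I & endvertex t0 (F v) w).

Definition suppression_order (s : seq T0) : Prop :=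
  uniq s /\ forall w, w \in s <-> suppressible w.

Definition base_tree (s : seq T0) : cgraph T0 :=
  foldl (@suppress T0) (CGraph [set: T0] t0 red_edge) s.

Definition overspan (e : {set T0}) : rel {v : V | v \notin I} :=
  [rel u v | [exists r, exists s, (e == [set r; s]) &&
     (if u == v then (r \in F (val u)) && (s \in F (val u))
      else G (val u) (val v) &&
           ((r \in F (val u)) && (s \in F (val v))
            || (s \in F (val u)) && (r \in F (val v))))]].

(* The family A(G), as an index set: (e, b) stands for a copy of overspan e,
   the second copy (e, true) being present for black edges only. *)
Definition overspan_family (K : cgraph T0) : {set {set T0} * bool} :=
  [set i | (i.1 \in edges (cadj K)) && (i.2 ==> (i.1 \notin edges (cred K)))].

Definition union_graph (B : {set {set T0} * bool}) : rel {v : V | v \notin I} :=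
  [rel u v | [exists i in B, overspan i.1 u v]].

End Overspan.

Arguments overspan [V] G [T0] F I e.
Arguments union_graph [V] G [T0] F I B.

(* Main.v *)
Require Import Defs.
From mathcomp Require Import all_boot.

(** Put the vertices carrying a loop of [G_B] aside. The trace on the base tree
    [T] of any other subtree [F v] is connected and contains no edge of [B], so
    a 2-colouring of [V(T)] that changes exactly along the edges of [B] is
    constant on it, while every edge of [G_B] between two such vertices changes
    the colour. Hence [G_B] without its looped vertices is bipartite, and
    Koenig's theorem applies. *)

Set Implicit Arguments.
Unset Strict Implicit.
Unset Printing Implicit Defensive.

(** * Koenig's theorem *)

Section Koenig.

Variable W : finType.
Implicit Types (E M : {set {set W}}) (C S : {set W}).

Definition transversal_of E C := [forall e in E, e :&: C != set0].

Lemma transversal_ofP E C :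
  reflect (forall e, e \in E -> exists2 x, x \in e & x \in C)
          (transversal_of E C).
Proof.
apply: (iffP forall_inP) => h e eE; have := h e eE.
  by case/set0Pn=> x /setIP[xe xC]; exists x.
by case=> x xe xC; apply/set0Pn; exists x; rewrite inE xe.
Qed.

Lemma transversal_of_sub E E' C :
  E' \subset E -> transversal_of E C -> transversal_of E' C.
Proof.
by move=> /subsetP sE /transversal_ofP h; apply/transversal_ofP=> e /sE /h.
Qed.

Lemma card_matching_transversal M C :
  trivIset M -> transversal_of M C -> #|M| <= #|C|.
Proof.
move=> /trivIsetP tM /transversal_ofP hC.
(* Singletons are chosen instead of vertices so that [set0] can serve as default value even if [W]
   is empty. *)
pose g (e : {set W}) := odflt set0 (omap set1 [pick x in e :&: C]).
have gP e : e \in M -> exists x, [/\ x \in e, x \in C & g e = [set x]].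
  case/hC=> x xe xC; rewrite /g; case: pickP => [y /setIP[ye yC]|/(_ x)].
    by exists y.
  by rewrite inE xe xC.
have g_inj : {in M &, injective g}.
  move=> e1 e2 e1M e2M.
  have [x [xe1 _ ->]] := gP _ e1M; have [y [ye2 _ ->]] := gP _ e2M.
  move/set1_inj=> exy; apply/eqP/negPn/negP=> /(tM _ _ e1M e2M)/pred0P/(_ x).
  by rewrite /= xe1 exy ye2.
rewrite -(card_in_imset g_inj) -(card_imset (mem C) (@set1_inj W)).
apply/subset_leq_card/subsetP=> _ /imsetP[e eM ->].
by have [x [_ xC ->]] := gP _ eM; apply: imset_f.
Qed.

Lemma transversal_of_card_le E :
  (forall e, e \in E -> e != set0) ->
  exists2 C, transversal_of E C & #|C| <= #|E|.
Proof.
move=> nE; case: (set_0Vmem E) => [->|[e0 e0E]].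
  by exists set0; rewrite ?cards0 //; apply/transversal_ofP=> e; rewrite inE.
have /set0Pn[x0 _] := nE _ e0E.
pose g (e : {set W}) := odflt x0 [pick x in e].
exists (g @: E); last exact: leq_imset_card.
apply/transversal_ofP=> e eE; exists (g e); last exact: imset_f.
rewrite /g; case: pickP => //= e_0; have /set0Pn[x] := nE _ eE.
by rewrite e_0.
Qed.

(** The lattice operation on transversals of a bipartite graph: meet in one
    class of the bipartition, join in the other one. *)
Definition mix (f : pred W) S1 S2 : {set W} :=
  [set w | if f w then (w \in S1) && (w \in S2) else (w \in S1) || (w \in S2)].

(** Injectivity of [f] leaves [e] at most one vertex in each class, which also allows singleton
    edges. Two chosen vertices in the meet class therefore coincide; otherwise one of them lies in
    the join class. *)
Lemma mix_transversal (f : pred W) (e S1 S2 : {set W}) :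
  {in e &, injective f} ->
  (exists2 x, x \in e & x \in S1) -> (exists2 x, x \in e & x \in S2) ->
  exists2 x, x \in e & x \in mix f S1 S2.
Proof.
move=> f_inj [a ae aS1] [b be bS2].
case fa: (f a); last by exists a; rewrite // inE fa aS1.
case fb: (f b); last by exists b; rewrite // inE fb bS2 orbT.
have eab : a = b by apply: f_inj; rewrite ?fa ?fb.
by exists a; rewrite // inE fa aS1 eab bS2.
Qed.

Lemma card_mix (f : pred W) S1 S2 :
  #|mix f S1 S2| + #|mix (predC f) S1 S2| = #|S1| + #|S2|.
Proof.
rewrite -!sum1_card !(big_mkcond (fun i => i \in _)) /= -!big_split.
apply: eq_bigr => w _ /=; rewrite !inE /=.
by case: (f w); case: (w \in S1); case: (w \in S2).
Qed.

(* In an edge-minimal subgraph with the same covering number, two edges sharing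
   [x] would give two small transversals avoiding [x], and mixing these two
   would yield a transversal that is too small. So that subgraph is a
   matching. *)
Theorem koenig (f : pred W) E :
  (forall e, e \in E -> e != set0 /\ {in e &, injective f}) ->
  exists M C, [/\ M \subset E, trivIset M, transversal_of E C & #|C| <= #|M|].
Proof.
move=> hE.
have coverT : transversal_of E setT.
  by apply/transversal_ofP=> e /hE[/set0Pn[x xe] _]; exists x.
case: (arg_minnP (fun C : {set W} => #|C|) coverT) => C0 C0E C0min.
pose heavy E' := [forall C, transversal_of E' C ==> (#|C0| <= #|C|)].
have heavyE : heavy E by apply/forallP=> C; apply/implyP; apply: C0min.
have [M /minsetP[heavyM minM] sME] := minset_exists heavyE.
have hM e : e \in M -> e != set0 /\ {in e &, injective f}.
  by move/(subsetP sME)/hE.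
exists M, C0; split=> //; last first.
  have [C CM leCM] : exists2 C, transversal_of M C & #|C| <= #|M|.
    by apply: transversal_of_card_le => e /hM[].
  by apply: leq_trans leCM; move/forallP/(_ C)/implyP: heavyM; apply.
(* By minimality of [M], fewer than [#|C0|] vertices suffice once [e] is removed; they must miss
   [e], or they would cover all of [M]. *)
have crit e : e \in M -> exists S, [/\ #|S| < #|C0|,
    forall d, d \in M -> d != e -> exists2 x, x \in d & x \in S
    & forall x, x \in e -> x \notin S].
  move=> eM; case: (boolP (heavy (M :\ e))) => [hv|].
    have := minM _ hv (subsetDl _ _); move/setP/(_ e).
    by rewrite !inE eqxx eM.
  case/forallPn=> S; rewrite negb_imply -ltnNge => /andP[Sc ltS].
  have cov d : d \in M -> d != e -> exists2 x, x \in d & x \in S.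
    by move=> dM de; move/transversal_ofP: Sc; apply; rewrite !inE de.
  exists S; split=> // x xe; apply/negP=> xS.
  have : transversal_of M S.
    apply/transversal_ofP=> d dM; case: (eqVneq d e) => [->|]; last exact: cov.
    by exists x.
  by move/forallP/(_ S)/implyP: heavyM => hm /hm; rewrite leqNgt ltS.
apply/trivIsetP=> e1 e2 e1M e2M ne12; apply/pred0Pn=> -[x /= /andP[xe1 xe2]].
have [S1 [lt1 cov1 out1]] := crit _ e1M.
have [S2 [lt2 cov2 out2]] := crit _ e2M.
pose g w := f w == f x.
have g_inj e : e \in M -> {in e &, injective g}.
  move=> /hM[_ fi] a b ae be; rewrite /g => gab; apply: fi => //.
  by move: gab; case: (f a); case: (f b); case: (f x).
have gC_inj e : e \in M -> {in e &, injective (predC g)}.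
  by move=> eM a b ae be /negb_inj; apply: g_inj eM _ _ ae be.
(* As [x] is the only vertex of its class in [e], a set that meets [e] but avoids [x] meets it in
   the other class, where [mix g] takes the join. *)
have other e S : e \in M -> x \in e -> x \notin S ->
    (exists2 y, y \in e & y \in S) -> exists2 y, y \in e & (y \in S) && ~~ g y.
  move=> eM xe xS [y ye yS]; exists y => //; rewrite yS /=.
  apply/negP=> gy; case/negP: xS; suff -> : x = y by [].
  by apply: (g_inj _ eM) => //; rewrite gy /g eqxx.
have cC1 : transversal_of M (mix g S1 S2).
  apply/transversal_ofP=> e eM; case: (eqVneq e e1) => [->|ne1].
    have [y ye /andP[yS gy]] :=
      other _ _ e1M xe1 (out2 _ xe2) (cov2 _ e1M ne12).
    by exists y; rewrite // inE (negPf gy) yS orbT.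
  case: (eqVneq e e2) => [->|ne2].
    have ne21 : e2 != e1 by rewrite eq_sym.
    have [y ye /andP[yS gy]] :=
      other _ _ e2M xe2 (out1 _ xe1) (cov1 _ e2M ne21).
    by exists y; rewrite // inE (negPf gy) yS.
  by apply: mix_transversal; [apply: g_inj | apply: cov1 | apply: cov2].
(* Here the meet is taken outside the class of [x], so [e1] and [e2] may be missed; adding [x]
   covers both. *)
have cC2 : transversal_of M (x |: mix (predC g) S1 S2).
  apply/transversal_ofP=> e eM; case: (eqVneq e e1) => [->|ne1].
    by exists x; rewrite ?setU11.
  case: (eqVneq e e2) => [->|ne2]; first by exists x; rewrite ?setU11.
  have [y ye yC] : exists2 y, y \in e & y \in mix (predC g) S1 S2.
    by apply: mix_transversal; [apply: gC_inj | apply: cov1 | apply: cov2].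
  by exists y; rewrite // inE yC orbT.
move/forallP: heavyM => hm.
(* The two transversals have at most [1 + #|S1| + #|S2|] elements in total, which is less than
   [2 * #|C0|]. *)
have := leq_add (implyP (hm _) cC1) (implyP (hm _) cC2); apply/negP.
rewrite -ltnNge cardsU1 addnCA card_mix.
apply: leq_ltn_trans (_ : _ <= 1 + (#|S1| + #|S2|)) _.
  by rewrite leq_add2r leq_b1.
by rewrite addnA add1n -addnS leq_add.
Qed.

End Koenig.

(** * Koenig's theorem for graphs with loops *)

Section LoopGraphKoenig.

Variables (W : finType) (H : rel W).

Lemma edgesP (e : {set W}) :
  reflect (exists x y, H x y /\ e = [set x; y]) (e \in edges H).
Proof.
rewrite inE; apply: (iffP existsP) => [[x /existsP[y /andP[h /eqP ->]]]|].
  by exists x, y.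
by move=> [x [y [h ->]]]; exists x; apply/existsP; exists y; rewrite h eqxx.
Qed.

Lemma vertex_coverT : vertex_cover H [set: W].
Proof.
apply/forall_inP=> e /edgesP[x [y [_ ->]]]; apply/set0Pn; exists x.
by rewrite setIT set21.
Qed.

Lemma nu_le_tau : nu H <= tau H.
Proof.
rewrite /nu /tau; case: arg_minnP => [|C Cc _]; first exact: vertex_coverT.
apply/bigmax_leqP=> M /andP[sM tM].
exact: card_matching_transversal tM (transversal_of_sub sM Cc).
Qed.

(** Koenig's theorem is applied to the loops and the edges avoiding looped vertices: a matching
    among these is a matching of [H], and a transversal of these contains every looped vertex, hence
    covers [H]. *)
Lemma nu_eq_tau (f : pred W) :
  (forall x y, H x y -> ~~ H x x -> ~~ H y y -> f x != f y) -> nu H = tau H.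
Proof.
move=> hf; apply/eqP; rewrite eqn_leq nu_le_tau /=.
(* Edges with exactly one looped end are covered once the loops are. *)
pose E := [set e in edges H | (#|e| == 1) || [forall x in e, ~~ H x x]].
have hE e : e \in E -> e != set0 /\ {in e &, injective f}.
  rewrite inE => /andP[/edgesP[x [y [hxy ->]]] h].
  split; first by apply/set0Pn; exists x; rewrite set21.
  case/orP: h => [/cards1P[z ->] a b /set1P-> /set1P-> //|/forall_inP h].
  have := hf _ _ hxy (h _ (set21 _ _)) (h _ (set22 _ _)).
  by move=> ne a b /set2P[]-> /set2P[]-> // efxy; rewrite efxy eqxx in ne.
have [M [C [sM tM /transversal_ofP Cc leCM]]] := koenig hE.
have covC : vertex_cover H C.
  have loopC x : H x x -> x \in C.
    move=> hx; case: (Cc [set x]) => [|y /set1P-> //].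
    rewrite inE cards1 eqxx /= andbT; apply/edgesP; exists x, x.
    by rewrite setUid.
  apply/forall_inP=> e eH.
  case: (boolP [forall x in e, ~~ H x x]) => [h|].
    have [|x xe xC] := Cc e; first by rewrite inE eH h orbT.
    by apply/set0Pn; exists x; rewrite inE xe.
  case/forall_inPn=> x xe /negPn/loopC xC.
  by apply/set0Pn; exists x; rewrite inE xe.
rewrite /tau; case: arg_minnP => [|C' _ minC']; first exact: vertex_coverT.
apply: leq_trans (minC' _ covC) (leq_trans leCM _).
apply: (bigmax_sup M) => //; rewrite /matching tM andbT.
by apply: subset_trans sM _; apply/subsetP=> e; rewrite inE => /andP[].
Qed.

End LoopGraphKoenig.

(** * Potentials on trees *)

(** Over Z/2, the edge labelling [b] is the coboundary of the vertex function [c]. *)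
Definition potential (T : finType) (e b : rel T) (c : pred T) : Prop :=
  forall x y, e x y -> c x (+) c y = b x y.

(** Induction on the number of edges: deleting an edge separates its ends, so flipping the colouring
    on the component of one end corrects the label of that edge without disturbing the others. *)
Lemma acyclic_potential (T : finType) (e b : rel T) :
  symmetric e -> irreflexive e -> symmetric b ->
  (forall c, ucycle e c -> size c <= 2) -> exists c, potential e b c.
Proof.
have [n] := ubnP #|[set p : T * T | e p.1 p.2]|.
elim: n e => // n IHn e le_n e_sym e_irr b_sym e_acyc.
case: (set_0Vmem [set p : T * T | e p.1 p.2]) => [e0|[[x y]]].
  exists pred0 => x y exy; have : (x, y) \in [set p : T * T | e p.1 p.2].
    by rewrite inE.
  by rewrite e0 inE.
rewrite inE /= => exy.
pose e' := [rel a d | e a d && ~~ (((a == x) && (d == y))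
                                   || ((a == y) && (d == x)))].
have e'_sub a d : e' a d -> e a d by case/andP.
have e'_sym : symmetric e'.
  by move=> a d /=; rewrite e_sym orbC ![(_ == x) && _]andbC.
have xy'N : ~~ connect e' x y.
  apply/negP=> /connectP[p0 /shortenP[p p_path p_uniq _] lastp].
  have cyc : ucycle e (x :: p).
    rewrite /ucycle p_uniq andbT /= rcons_path -lastp e_sym exy andbT.
    by apply: sub_path p_path.
  (* An empty [p] would give [x = y], and a [p] of length 1 would use the deleted edge. *)
  have := e_acyc _ cyc; case: p p_path lastp {p_uniq cyc} => [_ exy'|z [|//]].
    by rewrite /= in exy'; rewrite exy' e_irr in exy.
  by rewrite /= !andbT => + eyz; rewrite -eyz !eqxx andbF.
have [||||c' hc'] := IHn e' _ e'_sym.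
- rewrite -ltnS; apply: leq_trans le_n; rewrite ltnS; apply: proper_card.
  apply/properP; split; first by apply/subsetP=> -[a d]; rewrite !inE => /e'_sub.
  by exists (x, y); rewrite !inE //= !eqxx andbF.
- by move=> a /=; rewrite e_irr.
- exact: b_sym.
- move=> c /andP[cc uc]; apply: e_acyc; rewrite /ucycle uc andbT.
  by apply: sub_cycle cc.
pose X := connect e' x.
(* The error of [c'] on the deleted edge. *)
pose k := c' x (+) c' y (+) b x y.
exists (fun z => c' z (+) (X z && k)) => a d ead.
have Xx : X x by apply: connect0.
have Xy : X y = false by apply/negbTE.
have kP : (c' x (+) (X x && k)) (+) (c' y (+) (X y && k)) = b x y.
  by rewrite Xx Xy /k; case: (c' x); case: (c' y); case: (b x y).
case: (boolP (e' a d)) => [e'ad|].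
  have -> : X a = X d.
    by apply: (same_connect1r (sym_connect_sym e'_sym) e'ad).
  by rewrite -(hc' _ _ e'ad); case: (c' a); case: (c' d); case: (X d && k).
rewrite /= ead negbK /= => /orP[] /andP[/eqP-> /eqP->]; first exact: kP.
by rewrite addbC b_sym.
Qed.

(** * Suppression of vertices *)

Section Suppression.

Variable T : finType.
Implicit Types (K : cgraph T) (A : {set T}) (w : T).

(** Acyclicity in cohomological form, with coefficients in Z/2. *)
Definition has_potentials K : Prop :=
  forall b : rel T, symmetric b -> exists c, potential (cadj K) b c.

(* Connectedness of [A :&: cverts K] in [K], stated through colourings. *)
Definition monochromatic K A : Prop :=
  forall c : pred T,
    {in A &, forall x y, cadj K x y -> c x = c y} ->
    {in A :&: cverts K &, forall x y, c x = c y}.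

Lemma suppress_sym K w :
  symmetric (cadj K) -> symmetric (cadj (suppress K w)).
Proof.
move=> K_sym x y /=.
rewrite [cadj K y x]K_sym [cadj K y w]K_sym [cadj K w x]K_sym.
rewrite [y == x]eq_sym [cadj K x w && _]andbC.
by case: (x == w); case: (y == w).
Qed.

Lemma degree_le2 K w x y a :
  degree (cadj K) w <= 2 -> cadj K w x -> cadj K w y -> cadj K w a ->
  x != y -> (x == a) || (y == a).
Proof.
move=> dw wx wy wa nxy; apply/negPn/negP; rewrite negb_or => /andP[nxa nya].
have: #|[set x; y; a]| <= degree (cadj K) w.
  by apply/subset_leq_card/subsetP=> z; rewrite !inE => /orP[/orP[]|] /eqP->.
rewrite setUC cardsU1 cards2 nxy !inE negb_or ![a == _]eq_sym nxa nya /=.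
by move/leq_trans/(_ dw).
Qed.

Lemma degree_suppress K w x :
  symmetric (cadj K) -> degree (cadj K) w <= 2 ->
  degree (cadj (suppress K w)) x <= degree (cadj K) x.
Proof.
move=> K_sym dw; case: (boolP (cadj K x w)) => xw; last first.
  apply/subset_leq_card/subsetP=> y; rewrite !inE /= (negPf xw) orbF.
  by case/and4P.
pose N z := [set y | cadj K z y].
have sN : [set y | cadj (suppress K w) x y] \subset (N x :\ w) :|: (N w :\ x).
  apply/subsetP=> y; rewrite !inE => /and4P[_ -> nxy].
  by rewrite eq_sym nxy /= => /orP[->|/andP[_ ->]] //; rewrite orbT.
apply: leq_trans (subset_leq_card sN) _.
apply: leq_trans (leq_card_setU _ _).1 _.
have := cardsD1 w (N x); have := cardsD1 x (N w).
rewrite !inE xw K_sym xw /= /degree -/(N x) => eNw ->.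
rewrite addnC leq_add2r; move: dw; rewrite /degree -/(N w) eNw.
by rewrite add1n ltnS.
Qed.

Lemma has_potentials_suppress K w :
  symmetric (cadj K) -> degree (cadj K) w <= 2 ->
  has_potentials K -> has_potentials (suppress K w).
Proof.
move=> K_sym dw potK b b_sym.
pose a := odflt w [pick z | cadj K w z].
(* The edge from [w] to [a] is labelled 0, the other one inherits the label of
   the edge that replaces both. *)
pose b1 x y := if x == w then (y != a) && b a y
               else if y == w then (x != a) && b a x else b x y.
pose b2 x y := if (x == w) && (y == w) then false else b1 x y.
have b2_sym : symmetric b2.
  move=> x y; rewrite /b2 /b1 andbC.
  by case: (x == w); case: (y == w) => //=; rewrite b_sym.
have [c hc] := potK _ b2_sym.
exists c => x y /and4P[nxw nyw nxy /orP[/hc->|/andP[xw wy]]].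
  by rewrite /b2 /b1 (negPf nxw) (negPf nyw).
have wx : cadj K w x by rewrite K_sym.
have wa : cadj K w a by rewrite /a; case: pickP => // /(_ y); rewrite wy.
have := hc _ _ xw; have := hc _ _ wy.
rewrite /b2 /b1 (negPf nxw) (negPf nyw) eqxx /= => hwy hxw.
have -> : c x (+) c y = (c x (+) c w) (+) (c w (+) c y).
  by case: (c x); case: (c y); case: (c w).
(* [x] and [y] exhaust the neighbours of [w], so one of them is [a]. *)
rewrite hwy hxw; have /orP[/eqP exa|/eqP eya] := degree_le2 dw wx wy wa nxy.
  by rewrite -exa eqxx eq_sym nxy.
by rewrite -eya eqxx nxy /= addbF b_sym.
Qed.

(** A colouring of the suppressed graph extends to [w] by the colour of a neighbour in [A]; distinct
    neighbours of [w] in [A] become adjacent, so they agree on it. *)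
Lemma monochromatic_suppress K w A :
  symmetric (cadj K) -> monochromatic K A -> monochromatic (suppress K w) A.
Proof.
move=> K_sym mK c hc x y.
rewrite !inE => /and3P[xA nxw xK] /and3P[yA nyw yK].
pose a := odflt w [pick z in A | cadj K w z && (z != w)].
pose c1 z := if z == w then c a else c z.
have c1w z : z \in A -> cadj K w z -> z != w -> c a = c z.
  move=> zA wz nzw; rewrite /a; case: pickP => [d|/(_ z)]; last first.
    by rewrite zA wz nzw.
  case/and3P=> dA wd ndw /=; case: (eqVneq d z) => [-> //|ndz].
  by apply: hc; rewrite //= ndw nzw ndz [cadj K d w]K_sym wd wz orbT.
have := mK c1; rewrite /c1 => /(_ _ x y).
rewrite (negPf nxw) (negPf nyw) !inE xA xK yA yK; apply=> // p q pA qA pq.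
case: (eqVneq p w) => [epw|npw]; case: (eqVneq q w) => [eqw|nqw] //.
- by apply: c1w; rewrite // -epw.
- by apply/esym/c1w; rewrite // -eqw K_sym.
- case: (eqVneq p q) => [-> //|npq].
  by apply: hc; rewrite //= npw nqw npq pq.
Qed.

(* Enough of "[K] is a tree" to survive suppressions; the bound on the degrees
   concerns the vertices [s] still to be suppressed. *)
Record tree_like (F : {set {set T}}) (s : seq T) K : Prop := TreeLike {
  tl_sym : symmetric (cadj K);
  tl_irr : irreflexive (cadj K);
  tl_verts : forall x y, cadj K x y -> x \in cverts K;
  tl_degree : forall w, w \in s -> degree (cadj K) w <= 2;
  tl_pot : has_potentials K;
  tl_mono : {in F, forall A, monochromatic K A}
}.

Lemma tree_like_suppress F w s K :
  tree_like F (w :: s) K -> tree_like F s (suppress K w).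
Proof.
move=> [K_sym K_irr K_verts K_deg K_pot K_mono].
have dw : degree (cadj K) w <= 2 by apply: K_deg; rewrite mem_head.
split.
- exact: suppress_sym.
- by move=> x /=; rewrite eqxx !andbF.
- move=> x y /= /and4P[nxw _ _ h]; rewrite !inE nxw /=.
  by case/orP: h => [/K_verts|/andP[/K_verts]].
- move=> z zs; apply: leq_trans (degree_suppress z K_sym dw) _.
  by apply: K_deg; rewrite inE zs orbT.
- exact: has_potentials_suppress.
- by move=> A AF; apply: monochromatic_suppress => //; apply: K_mono.
Qed.

Lemma tree_like_foldl F s K :
  tree_like F s K -> tree_like F [::] (foldl (@suppress T) K s).
Proof. by elim: s K => //= w s IHs K /tree_like_suppress/IHs. Qed.

End Suppression.

(** * The base tree and its overspan graphs *)

Lemma base_tree_like (V : finType) (G : rel V) (T0 : finType) (t0 : rel T0)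
    (F : V -> {set T0}) (I : {set V}) (s : seq T0) :
  tree_representation G t0 F -> suppression_order t0 F I s ->
  tree_like [set F v | v : V] [::] (base_tree t0 F I s).
Proof.
move=> [[t_sym t_irr] [_ _ t_acyc] F_tree _] [_ s_supp].
apply: tree_like_foldl; split=> //=.
- by move=> w /s_supp[-> _].
- move=> b b_sym; apply: acyclic_potential => // c; apply: t_acyc => x.
  by rewrite inE.
- move=> _ /imsetP[v _ ->] c hc x y; rewrite !setIT => xF yF.
  have [_ /(_ x y xF yF)/connectP[p + ->] _] := F_tree v.
  elim: p x {xF} => //= z p IHp x /andP[/and3P[xF zF xz] zp].
  by rewrite (hc _ _ xF zF xz) (IHp _ zp).
Qed.

(** Irreflexivity makes an edge a genuine pair, so [r] and [s] are its two ends in one of the two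
    orders. *)
Lemma set2_edges (T : finType) (e : rel T) (r s : T) :
  symmetric e -> irreflexive e -> [set r; s] \in edges e -> e r s.
Proof.
move=> e_sym e_irr /edgesP[x [y [exy /setP eq]]].
have nxy : x != y by apply: contraTneq exy => ->; rewrite e_irr.
have: r \in [set x; y] by rewrite -eq set21.
have: s \in [set x; y] by rewrite -eq set22.
move=> /set2P[]es /set2P[]er; rewrite er es // in eq *.
- by have := eq y; rewrite setUid set22 inE eq_sym (negPf nxy).
- by rewrite e_sym.
- by have := eq x; rewrite setUid set21 inE (negPf nxy).
Qed.

Theorem lemma4p1 (V : finType) (G : rel V) (T0 : finType) (t0 : rel T0)
    (F : V -> {set T0}) (I : {set V}) (s : seq T0)
    (hG : simple_graph G) (hchordal : chordal G)
    (hrep : min_tree_representation G t0 F)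
    (hI : valid_I G t0 F I)
    (hs : suppression_order t0 F I s)
    (B : {set {set T0} * bool})
    (hB : B \subset overspan_family (base_tree t0 F I s)) :
  nu (union_graph G F I B) = tau (union_graph G F I B).
Proof.
have := base_tree_like hrep.1 hs; move: hB.
move: (base_tree t0 F I s) => K /subsetP hB [K_sym K_irr K_verts _ K_pot K_mono].
pose b x y := [exists i in B, i.1 == [set x; y]].
have [c hc] : exists c, potential (cadj K) b c.
  by apply: K_pot => x y; rewrite /b setUC.
(* The default [false] concerns only subtrees without a vertex in [K]; no edge of the union graph
   meets these. *)
pose f (u : {v : V | v \notin I}) :=
  if [pick r in F (val u) :&: cverts K] is Some r then c r else false.
have fE u r : ~~ union_graph G F I B u u ->
    r \in F (val u) -> r \in cverts K -> f u = c r.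
  move=> noloop rF rK.
  have rFK : r \in F (val u) :&: cverts K by rewrite inE rF.
  rewrite /f; case: pickP => [q qFK|/(_ r)]; last by rewrite rFK.
  apply: (K_mono (F (val u)) (imset_f _ _)) qFK rFK => // x y xF yF xy.
  have := hc _ _ xy; suff -> : b x y = false by case: (c x); case: (c y).
  (* An edge of [B] with both ends in [F (val u)] would put a loop at [u]. *)
  apply: contraNF noloop => /exists_inP[i iB exy].
  apply/exists_inP; exists i => //=; apply/existsP; exists x.
  by apply/existsP; exists y; rewrite exy eqxx xF yF.
apply: (@nu_eq_tau _ _ f) => u v huv nlu nlv.
have nuv : u != v by apply: contraTneq huv => ->.
case/exists_inP: huv => i iB /existsP[r /existsP[q /andP[/eqP ei]]].
rewrite (negPf nuv) => /andP[_ h].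
have rq : cadj K r q.
  by have := hB _ iB; rewrite inE ei => /andP[/set2_edges + _]; apply.
have qr : cadj K q r by rewrite K_sym.
have := hc _ _ rq; have -> : b r q by apply/exists_inP; exists i; rewrite ?ei.
have rK := K_verts _ _ rq; have qK := K_verts _ _ qr.
(* [r] and [q] have different colours, and these are [f u] and [f v] in some order. *)
case/orP: h => /andP[hu hv]; rewrite (fE _ _ nlu hu) // (fE _ _ nlv hv) //.
  by case: (c r); case: (c q).
by case: (c r); case: (c q).
Qed.
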